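(* Let $\varepsilon>0$ and $\sigma\ge 1/16$. Let $\{\bm{\phi}^{k}\}_{k=0}^{M}\subset\mathring{\mathcal V}_h$ be a solution of the mBDF2 scheme, i.e. for all $1\le i\le N-1$ and $1\le j\le M-1$, $$\frac{3\phi_i^{j+1}-4\phi_i^{j}+\phi_i^{j-1}}{2\tau}=\delta_h^\alpha\mu_i^{j+1},\qquad \mu_i^{j+1}=(\phi_i^{j+1})^3-2\phi_i^{j}+\phi_i^{j-1}-\varepsilon^2\delta_h^\alpha\phi_i^{j+1}-\sigma\tau\,\delta_h^\alpha(\phi_i^{j+1}-\phi_i^{j}).$$ For $0\le k\le M-1$ define the modified energy $$\mathcal E_h(\bm{\phi}^{k+1},\bm{\phi}^{k})=E_h(\bm{\phi}^{k+1})+\frac{1}{4\tau}\|\bm{\phi}^{k+1}-\bm{\phi}^{k}\|_{-1}^2+\frac12\|\bm{\phi}^{k+1}-\bm{\phi}^{k}\|_2^2 .$$ Then $$\mathcal E_h(\bm{\phi}^{k+1},\bm{\phi}^{k})\le \mathcal E_h(\bm{\phi}^{k},\bm{\phi}^{k-1})\qquad\text{for all } 1\le k\le M-1 .$$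
   Context: Let $1<\alpha<2$, $L,T>0$, $\Omega=(-L,L)$, $|\Omega|=2L$. For positive integers $M,N$ (with $N\ge2$) put $\tau=T/M$, $h=2L/N$, $x_i=-L+ih$, $t_j=j\tau$. Let $\gamma=1+\frac{\alpha}{2}$, $\nu=\gamma-\alpha=1-\frac{\alpha}{2}$, $c_{1,\alpha}=\frac{2^{\alpha-1}\alpha\,\Gamma(\frac{\alpha+1}{2})}{\sqrt\pi\,\Gamma(1-\frac{\alpha}{2})}$, $c_h^{(\alpha,\gamma)}=\frac{c_{1,\alpha}}{\nu h^\alpha}$, and $$g_0^{(\alpha)}=\sum_{\ell=1}^{N-1}\frac{(\ell+1)^\nu-(\ell-1)^\nu}{\ell^\gamma}+\frac{N^\nu-(N-1)^\nu}{N^\gamma}+\frac{2\nu}{\alpha N^\alpha},\qquad g_k^{(\alpha)}=g_{-k}^{(\alpha)}=-\frac{(k+1)^\nu-(k-1)^\nu}{2k^\gamma}\quad(1\le k\le N-2).$$ Let $\mathring{\mathcal V}_h=\{\bm v=(v_0,\dots,v_N)\in\mathbb R^{N+1}: v_0=v_N=0\}$. The discrete operator $\delta_h^\alpha$ acts on $\bm v\in\mathring{\mathcal V}_h$ by $\delta_h^\alpha v_i=-c_h^{(\alpha,\gamma)}\sum_{k=1}^{N-1}g_{i-k}^{(\alpha)}v_k$ for $1\le i\le N-1$ (and zero at $i=0,N$). Discrete inner product and norms: $(\bm u,\bm v)=h\sum_{k=0}^N u_kv_k$, $\|\bm u\|_p^p=h\sum_{k=0}^N|u_k|^p$ for $1\le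 p<\infty$. The operator $-\delta_h^\alpha$ is positive definite and self-adjoint on $\mathring{\mathcal V}_h$; $\tilde\delta_h$ denotes its unique (positive) square root, so $(\bm u,-\delta_h^\alpha\bm v)=(\tilde\delta_h\bm u,\tilde\delta_h\bm v)$, and $\|\bm u\|_{-1}^2=((-\delta_h^\alpha)^{-1}\bm u,\bm u)$. The discrete energy is $$E_h(\bm\phi)=\frac14\|\bm\phi\|_4^4-\frac12\|\bm\phi\|_2^2+\frac14|\Omega|+\frac{\varepsilon^2}{2}\|\tilde\delta_h\bm\phi\|_2^2 .$$ *)

(* Defs.v *)
From HB Require Import structures.
From mathcomp Require Import all_boot all_order all_algebra.
From mathcomp Require Import all_classical all_reals all_analysis.

Set Implicit Arguments.
Unset Strict Implicit.
Unset Printing Implicit Defensive.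

Import Order.TTheory GRing.Theory Num.Theory.
Import numFieldNormedType.Exports.

Local Open Scope classical_set_scope.
Local Open Scope ring_scope.

(* Euler's Gamma function, for a positive argument. *)
Definition Gamma (R : realType) (x : R) : R :=
  \int[@lebesgue_measure R]_(t in `]0, +oo[) (t `^ (x - 1) * expR (- t)).

Definition gam (R : realType) (alpha : R) : R := 1 + alpha / 2.

Definition nu (R : realType) (alpha : R) : R := gam alpha - alpha.

Definition c1 (R : realType) (alpha : R) : R :=
  2 `^ (alpha - 1) * alpha * Gamma ((alpha + 1) / 2) /
    (Num.sqrt pi * Gamma (1 - alpha / 2)).

Definition mesh (R : realType) (L : R) (N : nat) : R := 2 * L / N%:R.

Definition ch (R : realType) (L alpha : R) (N : nat) : R :=
  c1 alpha / (nu alpha * mesh L N `^ alpha).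

Definition g0 (R : realType) (alpha : R) (N : nat) : R :=
  \sum_(1 <= l < N)
     ((l%:R + 1) `^ nu alpha - (l%:R - 1) `^ nu alpha) / l%:R `^ gam alpha
  + (N%:R `^ nu alpha - (N%:R - 1) `^ nu alpha) / N%:R `^ gam alpha
  + 2 * nu alpha / (alpha * N%:R `^ alpha).

(* The coefficient g_z for an integer z. The even extension g_{-k} = g_k is
   built in; only the values |z| <= N - 2 are ever used. *)
Definition g (R : realType) (alpha : R) (N : nat) (z : int) : R :=
  if z == 0 then g0 alpha N
  else - (((absz z)%:R + 1) `^ nu alpha - ((absz z)%:R - 1) `^ nu alpha) /
         (2 * (absz z)%:R `^ gam alpha).

(* A grid function (v_0, ..., v_N) is a column vector 'cV[R]_N.+1. *)
Definition V0h (R : realType) (N : nat) : set 'cV[R]_N.+1 :=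
  [set v | v ord0 0 = 0 /\ v ord_max 0 = 0].

Definition delta_h (R : realType) (L alpha : R) (N : nat) (v : 'cV[R]_N.+1) :
    'cV[R]_N.+1 :=
  \col_(i < N.+1)
    if (0 < i < N)%N then
      - ch L alpha N *
        \sum_(1 <= k < N) g alpha N (i%:Z - k%:Z) * v (inord k) 0
    else 0.

Definition dotph (R : realType) (L : R) (N : nat) (u v : 'cV[R]_N.+1) : R :=
  mesh L N * \sum_(k < N.+1) u k 0 * v k 0.

(* The p-th power of the discrete p-norm. *)
Definition normph (R : realType) (L : R) (N p : nat) (u : 'cV[R]_N.+1) : R :=
  mesh L N * \sum_(k < N.+1) `|u k 0| ^+ p.

(* The matrix S restricts to a self-adjoint positive definite operator on V0h
   whose square is - delta_h. Only this restriction is determined. *)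
Definition is_pos_sqrt (R : realType) (L alpha : R) (N : nat)
    (S : 'M[R]_N.+1) : Prop :=
  [/\ forall v, V0h v -> V0h (S *m v),
      forall u v, V0h u -> V0h v -> dotph L (S *m u) v = dotph L u (S *m v),
      forall v, V0h v -> v != 0 -> 0 < dotph L (S *m v) v
    & forall v, V0h v -> S *m (S *m v) = - delta_h L alpha v].

Definition sqrt_delta_h (R : realType) (L alpha : R) (N : nat)
    (v : 'cV[R]_N.+1) : 'cV[R]_N.+1 :=
  xget 0 [set S : 'M[R]_N.+1 | is_pos_sqrt L alpha S] *m v.

(* The inverse of - delta_h as an operator on V0h. *)
Definition inv_delta_h (R : realType) (L alpha : R) (N : nat)
    (u : 'cV[R]_N.+1) : 'cV[R]_N.+1 :=
  xget 0 [set w : 'cV[R]_N.+1 | V0h w /\ - delta_h L alpha w = u].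

Definition norm_m1_sq (R : realType) (L alpha : R) (N : nat)
    (u : 'cV[R]_N.+1) : R :=
  dotph L (inv_delta_h L alpha u) u.

Definition Eh (R : realType) (L alpha eps : R) (N : nat)
    (phi : 'cV[R]_N.+1) : R :=
  1 / 4 * normph L 4 phi - 1 / 2 * normph L 2 phi + 1 / 4 * (2 * L)
  + eps ^+ 2 / 2 * normph L 2 (sqrt_delta_h L alpha phi).

(* mu^{j+1}, from pnew = phi^{j+1}, p = phi^j and pold = phi^{j-1}. *)
Definition mu_bdf2 (R : realType) (L alpha eps sigma tau : R) (N : nat)
    (pnew p pold : 'cV[R]_N.+1) : 'cV[R]_N.+1 :=
  \col_(i < N.+1)
    (pnew i 0 ^+ 3 - 2 * p i 0 + pold i 0
     - eps ^+ 2 * delta_h L alpha pnew i 0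
     - sigma * tau * delta_h L alpha (pnew - p) i 0).

Definition mBDF2_solution (R : realType) (L alpha eps sigma tau : R)
    (M N : nat) (phi : nat -> 'cV[R]_N.+1) : Prop :=
  (forall k, (k <= M)%N -> V0h (phi k)) /\
  (forall (j : nat) (i : 'I_N.+1), (1 <= j <= M - 1)%N -> (1 <= i <= N - 1)%N ->
    (3 * phi j.+1 i 0 - 4 * phi j i 0 + phi (j - 1)%N i 0) / (2 * tau) =
    delta_h L alpha
      (mu_bdf2 L alpha eps sigma tau (phi j.+1) (phi j) (phi (j - 1)%N)) i 0).

(* The modified energy of the pair (pnew, p) = (phi^{k+1}, phi^k). *)
Definition modEh (R : realType) (L alpha eps tau : R) (N : nat)
    (pnew p : 'cV[R]_N.+1) : R :=
  Eh L alpha eps pnew + 1 / (4 * tau) * norm_m1_sq L alpha (pnew - p)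
  + 1 / 2 * normph L 2 (pnew - p).

(* Main.v *)
Require Import Defs.
From HB Require Import structures.
From mathcomp Require Import all_boot all_order all_algebra.
From mathcomp Require Import all_classical all_reals all_analysis.
From mathcomp Require Import measurable_realfun complex ring lra zify.
Import Order.TTheory GRing.Theory Num.Theory.
Import numFieldNormedType.Exports.
Local Open Scope ring_scope.

(** Write [A] for [- delta_h], [d] for the new increment [phi^{k+1} - phi^k] and
    [e] for the previous one.  Applying [A^-1] to the scheme and pairing with
    [d] gives [(3 |d|_{-1}^2 - (e, d)_{-1}) / (2 tau) + (mu, d) = 0].

    - The time difference is at least
      [(|d|_{-1}^2 - |e|_{-1}^2) / (4 tau) + |d|_{-1}^2 / tau], because
      [2 (e, d)_{-1} <= |e|_{-1}^2 + |d|_{-1}^2].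
    - The nonlinear and extrapolated terms of [(mu, d)] are at least the
      increment of the double well minus [|e|^2 / 2], pointwise
      ([double_well_step]); the [eps] term is at least the increment of the
      fractional energy, by convexity.
    - What is left to absorb is [|d|^2 / 2], the increment of the last term of
      the modified energy being [(|d|^2 - |e|^2) / 2].  Expanding
      [|d - (tau / 4) A d|_{-1}^2 >= 0] gives
      [|d|^2 / 2 <= |d|_{-1}^2 / tau + (tau / 16) (A d, d)]
      ([dotph_le_stiff]), and the stabilization [sigma tau (A d, d)] pays for
      the second term as soon as [sigma >= 1 / 16].

    All this presupposes that [A] is symmetric and positive definite on [V0h],
    that it has an inverse there and that a positive square root exists.
    Positive definiteness ([stiff_posdef]) is strict diagonal dominance: the
    coefficients [g_k] are nonpositive off the diagonal and [g_0] exceeds twice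
    the sum of their absolute values.  It also needs the scaling constant to be
    positive, that is, the convergence and positivity of two Gamma integrals
    ([Gamma_gt0]).  The square root comes from the spectral theorem
    ([sym_posdef_poly_root4], [exists_pos_sqrt]). *)

Set Implicit Arguments.
Unset Strict Implicit.
Unset Printing Implicit Defensive.

(** * Symmetric positive definite matrices *)

Definition posdef_mx (R : numDomainType) n (A : 'M[R]_n) :=
  forall v : 'cV[R]_n, v != 0 -> 0 < (v^T *m A *m v) 0 0.

Lemma exists_interpolation (F : fieldType) (s : seq F) (f : F -> F) :
  exists p : {poly F}, {in s, forall x, p.[x] = f x}.
Proof.
elim: s => [|a s [p hp]]; first by exists 0 => x; rewrite in_nil.
have [as_|/negP as_] := boolP (a \in s).
  by exists p => x; rewrite inE => /orP[/eqP->|]; exact: hp.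
pose q := \prod_(y <- s) ('X - y%:P).
have qa : q.[a] != 0 by rewrite -[_ == 0]/(root q a) root_prod_XsubC; apply/negP.
exists (p + ((f a - p.[a]) / q.[a])%:P * q) => x; rewrite !hornerE inE.
case/orP=> [/eqP->|xs]; first by rewrite divfK // addrC subrK.
have /eqP-> : q.[x] == 0 by rewrite -[_ == 0]/(root q x) root_prod_XsubC.
by rewrite mulr0 addr0 hp.
Qed.

Lemma posdef_eigenvalue_gt0 (R : realFieldType) n (A : 'M[R]_n) a :
  posdef_mx A -> eigenvalue A a -> 0 < a.
Proof.
move=> Apos /eigenvalueP[v vA v0].
have := Apos v^T; rewrite trmx_eq0 trmxK => /(_ v0).
rewrite vA -scalemxAl mxE mulrC pmulr_rgt0 //.
rewrite lt_def mxE; apply/andP; split; last first.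
  by apply: sumr_ge0 => i _; rewrite mxE -expr2 sqr_ge0.
apply: contra_neq v0 => /eqP.
rewrite psumr_eq0 => [/allP v0|i _]; last by rewrite mxE -expr2 sqr_ge0.
apply/rowP => i; have := v0 i; rewrite mem_index_enum => /(_ isT) /=.
by rewrite !mxE mulf_eq0 orbb => /eqP.
Qed.

(** Over the complex closure the spectral theorem diagonalizes [A]; its
    eigenvalues are real and positive, so the real fourth roots can be
    interpolated at them by a real polynomial.  The point of taking a polynomial
    in [A], rather than a conjugate of a diagonal matrix, is that every subspace
    stable under [A] is stable under it; the point of the exponent 4 is that the
    square of [horner_mx A p] is then visibly positive, being the square of a
    symmetric matrix. *)
Lemma sym_posdef_poly_root4 (R : rcfType) n (A : 'M[R]_n.+1) :
  A^T = A -> posdef_mx A -> exists p : {poly R}, horner_mx A p ^+ 4 = A.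
Proof.
move=> Asym Apos.
pose toC : {rmorphism R -> R[i]} := real_complex R.
pose AC := map_mx toC A.
have ACherm : AC \is hermsymmx.
  apply: realsym_hermsym.
    apply/is_hermitianmxP; rewrite expr0 scale1r map_mx_id //.
    by rewrite /AC map_trmx Asym.
  by apply/mxOverP => i j; rewrite mxE complex_real.
have /orthomx_spectralP := hermitian_normalmx ACherm.
set P := spectralmx AC; set d := spectral_diag AC => ACE.
have Punit : P \in unitmx := spectral_unit AC.
have d_eigen i : eigenvalue AC (d 0 i).
  apply/eigenvalueP; exists (row i P).
    rewrite -row_mul ACE !mulmxA mulmxV // mul1mx.
    by rewrite row_mul row_diag_mx -scalemxAl -rowE.
  apply: contraTneq Punit => Pi0; rewrite -row_free_unit.
  apply/negP => /row_freeP[Q PQ].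
  have := congr1 (fun M => (row i M) 0 i) PQ.
  by rewrite row_mul Pi0 mul0mx !mxE eqxx => /eqP; rewrite eq_sym oner_eq0.
have d_pos i : exists2 a, d 0 i = toC a & 0 < a.
  have /mxOverP/(_ 0 i)/complex_realP[a da] :=
    hermitian_spectral_diag_real ACherm.
  exists a => //; apply: posdef_eigenvalue_gt0 Apos _.
  have := d_eigen i; rewrite !eigenvalue_root_char /AC -map_char_poly da.
  by rewrite fmorph_root.
have [p hp] := exists_interpolation
  [seq complex.Re (d 0 i) | i <- enum 'I_n.+1] (fun x => Num.sqrt (Num.sqrt x)).
(* p ^ 4 - 'X vanishes on the spectrum, hence annihilates the diagonal form. *)
exists p; apply/eqP; rewrite -subr_eq0.
rewrite -[X in _ - X]horner_mx_X -rmorphXn -rmorphB /=.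
rewrite -(map_mx_eq0 toC) map_horner_mx -/AC ACE.
rewrite horner_mx_uconjC // horner_mx_diag.
rewrite [X in diag_mx X](_ : _ = 0) ?linear0 ?mulmx0 ?mul0mx //.
apply/rowP => i; rewrite !mxE; have [a da a0] := d_pos i.
rewrite da horner_map /= !hornerE.
have -> : p.[a] = Num.sqrt (Num.sqrt a).
  have -> : a = complex.Re (d 0 i) by rewrite da.
  by apply: hp; apply: map_f; rewrite mem_enum.
rewrite (_ : 4 = 2 * 2)%N // exprM !sqr_sqrtr ?sqrtr_ge0 ?(ltW a0) //.
by rewrite subrr.
Qed.

Lemma trmx_horner_mx (R : comNzRingType) n (A : 'M[R]_n.+1) p :
  (horner_mx A p)^T = horner_mx A^T p.
Proof.
elim/poly_ind: p => [|p c IHp]; first by rewrite !rmorph0 trmx0.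
rewrite !rmorphD !rmorphM /= !horner_mx_X !horner_mx_C linearD /= tr_scalar_mx.
congr (_ + _); rewrite trmx_mul IHp.
exact: comm_mx_horner.
Qed.

Lemma posdef_unitmx (R : numFieldType) n (A : 'M[R]_n) : posdef_mx A -> A \in unitmx.
Proof.
move=> Apos; rewrite -unitmx_tr -row_free_unit -kermx_eq0.
apply/eqP/row_matrixP => i; rewrite row0; apply/eqP/negPn/negP => v0.
have Av0 : A *m (row i (kermx A^T))^T = 0.
  by apply: trmx_inj; rewrite trmx_mul trmxK -row_mul mulmx_ker row0 trmx0.
have := Apos (row i (kermx A^T))^T; rewrite trmx_eq0 => /(_ v0).
by rewrite -mulmxA Av0 mulmx0 mxE ltxx.
Qed.

(** By [|v i * v k| <= (v i ^ 2 + v k ^ 2) / 2] and symmetry, the quadratic form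
    is at least [\sum_i (A i i - \sum_(k | k != i) |A i k|) * v i ^ 2]. *)
Lemma diag_dominant_posdef (R : realFieldType) n (A : 'M[R]_n) :
  A^T = A -> (forall i, \sum_(k | k != i) `|A i k| < A i i) -> posdef_mx A.
Proof.
move=> Asym Adom v v0.
have -> : (v^T *m A *m v) 0 0 = \sum_i \sum_k A i k * (v i 0 * v k 0).
  rewrite mxE exchange_big /=; apply: eq_bigr => k _.
  rewrite mxE mulr_suml; apply: eq_bigr => i _; rewrite mxE; ring.
pose s i := \sum_(k | k != i) `|A i k|.
have swap : \sum_i \sum_(k | k != i) `|A i k| * v k 0 ^+ 2 =
            \sum_i \sum_(k | k != i) `|A i k| * v i 0 ^+ 2.
  rewrite (exchange_big_dep xpredT) //=; apply: eq_bigr => k _.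
  by apply: eq_big => i; rewrite 1?eq_sym // => _; rewrite -[in LHS]Asym mxE.
suff lb : \sum_i (A i i - s i) * v i 0 ^+ 2 <=
          \sum_i \sum_k A i k * (v i 0 * v k 0).
  apply: lt_le_trans lb; have [i vi] : exists i, v i 0 != 0.
    apply/existsP; apply: contraNT v0 => /existsPn v0.
    by apply/eqP/colP => i; rewrite !mxE; apply/eqP; have := v0 i; rewrite negbK.
  rewrite (bigD1 i) //= ltr_pwDl //.
    by rewrite mulr_gt0 ?subr_gt0 ?Adom // lt_def sqr_ge0 sqrf_eq0 vi.
  by apply: sumr_ge0 => k _; rewrite mulr_ge0 ?sqr_ge0 // subr_ge0 ltW // Adom.
have -> : \sum_i (A i i - s i) * v i 0 ^+ 2 = \sum_i (A i i * v i 0 ^+ 2 -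
   \sum_(k | k != i) `|A i k| * (v i 0 ^+ 2 + v k 0 ^+ 2) / 2).
  rewrite [RHS]sumrB [X in _ - X](_ : _ = \sum_i s i * v i 0 ^+ 2).
    by rewrite -sumrB; apply: eq_bigr => i _; rewrite mulrBl.
  have half : \sum_i \sum_(k | k != i) `|A i k| * v i 0 ^+ 2 =
              \sum_i s i * v i 0 ^+ 2.
    by apply: eq_bigr => i _; rewrite mulr_suml.
  rewrite -half [RHS]splitr -{2}swap -mulrDl -big_split mulr_suml /=.
  apply: eq_bigr => i _; rewrite -big_split mulr_suml /=.
  by apply: eq_bigr => k _; rewrite mulrDr.
apply: ler_sum => i _; rewrite [X in _ <= X](bigD1 i) //= lerD ?expr2 //.
rewrite -sumrN; apply: ler_sum => k _.
have h1 := ler_norm (- (A i k * (v i 0 * v k 0))); rewrite normrN !normrM in h1.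
have : `|v i 0| * `|v k 0| <= (v i 0 ^+ 2 + v k 0 ^+ 2) / 2.
  rewrite -(real_normK (num_real (v i 0))) -(real_normK (num_real (v k 0))).
  have := sqr_ge0 (`|v i 0| - `|v k 0|); rewrite !expr2; nra.
have := normr_ge0 (A i k); nra.
Qed.

(** * Positivity of the Gamma integral *)

Section Gamma.
Local Open Scope classical_set_scope.
Variables (R : realType) (x : R).
Hypothesis x_gt0 : 0 < x.
Let mu := @lebesgue_measure R.
Let integrand (t : R) := t `^ (x - 1) * expR (- t).
(* A single bounded primitive, t ^ x / (1 + t) ^ x, whose derivative dominates
   the integrand up to a constant both near 0 and near infinity. *)
Let primitive (t : R) := t `^ x * (1 + t) `^ (- x).
Let majorant (t : R) := x * t `^ (x - 1) * (1 + t) `^ (- (x + 1)).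

(** The maximum of [(1 + t) ^ (x + 1) * exp (- t)] is at [t = x]; the bound is
    the tangent inequality for [ln] there. *)
Lemma powR1D_le_expR (t : R) : 0 < t ->
  (1 + t) `^ (x + 1) <= (x + 1) `^ (x + 1) * expR t.
Proof.
move=> t0; have x1 : 0 < x + 1 by rewrite addr_gt0.
have x1' : x + 1 != 0 by rewrite gt_eqF.
rewrite /powR !gt_eqF ?addr_gt0 // -expRD ler_expR.
have -> : 1 + t = (x + 1) * ((1 + t) / (x + 1)) by field.
rewrite lnM ?posrE ?divr_gt0 // ?addr_gt0 // mulrDr lerD2l.
have h := @le_ln1Dx R ((t - x) / (x + 1)).
have e : 1 + (t - x) / (x + 1) = (1 + t) / (x + 1) by field.
rewrite e in h.
have -> : t = (x + 1) * (t / (x + 1)) by field.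
rewrite ler_pM2l // [X in (1 + X) / _](_ : _ = t); last by field.
apply: (le_trans (h _)).
  by rewrite -subr_gt0 opprK addrC e divr_gt0 // addr_gt0.
by rewrite ler_pM2r ?invr_gt0 // lerBlDr lerDl ltW.
Qed.

Lemma is_derive_primitive (t : R) : 0 < t -> is_derive t 1 primitive (majorant t).
Proof.
move=> t0; have t1 : 0 < 1 + t by lra.
have h0 := is_derive1_powR x t0.
have h1 : is_derive t 1 (fun u => (1 + u) `^ (- x)) (- x * (1 + t) `^ (- x - 1)).
  have h := is_derive1_powR (- x) t1.
  have := @is_derive1_comp R (fun u => u `^ (- x)) (fun u => 1 + u) t _ _ h.
  move=> /(_ 1) h'; rewrite -[X in is_derive _ _ _ X]mulr1; apply: h'.
  by apply: is_derive_eq; rewrite add0r mulr1.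
apply: is_derive_eq; rewrite /majorant /GRing.scale /=.
have -> : t `^ x = t `^ (x - 1) * t.
  by rewrite -[X in _ * X](powRr1 (ltW t0)) -powRD ?subrK // gt_eqF ?implybT.
have -> : (1 + t) `^ (- x) = (1 + t) `^ (- x - 1) * (1 + t).
  by rewrite -[X in _ * X](powRr1 (ltW t1)) -powRD ?subrK // (gt_eqF t1) implybT.
rewrite opprD; ring.
Qed.

Lemma integrand_le_majorant (t : R) : 0 < t ->
  integrand t <= (x + 1) `^ (x + 1) / x * majorant t.
Proof.
move=> t0; have x0' : x != 0 by rewrite gt_eqF.
have -> : (x + 1) `^ (x + 1) / x * majorant t =
  t `^ (x - 1) * ((x + 1) `^ (x + 1) * (1 + t) `^ (- (x + 1))).
  by rewrite /majorant; field.
rewrite /integrand ler_wpM2l ?powR_ge0 // expRN powRN.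
rewrite ler_pdivlMr ?powR_gt0 ?addr_gt0 //.
by rewrite mulrC ler_pdivrMr ?expR_gt0 //; exact: powR1D_le_expR.
Qed.

Lemma continuous_powR_at (a t : R) : 0 < t ->
  {for t, continuous (fun u : R => u `^ a)}.
Proof.
move=> t0; apply/differentiable_continuous/derivable1_diffP.
exact: (@ex_derive _ _ _ _ _ _ _ (is_derive1_powR a t0)).
Qed.

Lemma continuous_majorant (t : R) : 0 < t -> {for t, continuous majorant}.
Proof.
move=> t0; apply: continuousM.
  apply: continuousM; first exact: cst_continuous.
  exact: continuous_powR_at.
have t1 : 0 < 1 + t by rewrite addr_gt0.
have c1 : {for t, continuous (fun u : R => 1 + u)}.
  by apply: continuousD => //; exact: cst_continuous.
exact: (@continuous_comp R R R (fun u => 1 + u) (fun u => u `^ (- (x + 1)))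
  t c1 (@continuous_powR_at _ _ t1)).
Qed.

Lemma continuous_primitive (t : R) : 0 < t -> {for t, continuous primitive}.
Proof.
move=> t0; apply/differentiable_continuous/derivable1_diffP.
exact: (@ex_derive _ _ _ _ _ _ _ (is_derive_primitive t0)).
Qed.

Lemma measurable_integrand (D : set R) : measurable_fun D integrand.
Proof.
apply: measurable_funTS; apply: measurable_funM.
  exact: measurable_powR.
by apply: measurableT_comp => //; exact: measurable_funN.
Qed.

Lemma integrand_ge0 (t : R) : 0 <= integrand t.
Proof. by rewrite mulr_ge0 ?powR_ge0 ?expR_ge0. Qed.

Lemma primitive_01 (t : R) : 0 < t -> 0 <= primitive t <= 1.
Proof.
move=> t0; rewrite /primitive mulr_ge0 ?powR_ge0 //= powRN.
rewrite ler_pdivrMr ?powR_gt0 ?addr_gt0 //.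
by rewrite mul1r ge0_ler_powR ?nnegrE ?addr_ge0 ?(ltW t0) ?(ltW x_gt0) // lerDr.
Qed.

(** The bound is uniform in the interval, since [primitive] stays in [[0, 1]]. *)
Lemma integral_integrand_le (a b : R) : 0 < a -> a < b ->
  (\int[mu]_(t in `[a, b]) (integrand t)%:E <= ((x + 1) `^ (x + 1) / x)%:E)%E.
Proof.
move=> a0 ab; set K := _ / x; have K0 : 0 <= K by rewrite divr_ge0 ?powR_ge0 ?ltW.
have cmaj : {within `[a, b], continuous majorant}.
  apply: continuous_in_subspaceT => t; rewrite inE/= in_itv/= => /andP[at_ _].
  by apply: continuous_majorant; exact: lt_le_trans at_.
have mmaj : measurable_fun `[a, b] majorant.
  exact: subspace_continuous_measurable_fun.
apply: (@le_trans _ _ (\int[mu]_(t in `[a, b]) (K * majorant t)%:E)%E).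
  apply: ge0_le_integral => //.
  - by move=> t _; rewrite lee_fin integrand_ge0.
  - by apply/measurable_EFinP; exact: measurable_integrand.
  - by apply/measurable_EFinP; apply: measurable_funM.
  - move=> t /=; rewrite in_itv/= => /andP[at_ _]; rewrite lee_fin.
    by apply: integrand_le_majorant; exact: lt_le_trans at_.
under eq_integral do rewrite EFinM.
rewrite ge0_integralZl //; last 2 first.
- exact/measurable_EFinP.
- by move=> t _; rewrite lee_fin !mulr_ge0 ?powR_ge0 // ltW.
rewrite (@continuous_FTC2 _ majorant primitive) //.
- rewrite -EFinB -EFinM lee_fin ler_piMr //.
  have := primitive_01 a0; have := primitive_01 (lt_trans a0 ab); lra.
- split.
  + move=> t; rewrite in_itv/= => /andP[at_ _].
    exact: (@ex_derive _ _ _ _ _ _ _ (is_derive_primitive (lt_trans a0 at_))).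
  + exact/cvg_at_right_filter/continuous_primitive.
  + exact/cvg_at_left_filter/continuous_primitive/(lt_trans a0).
- move=> t; rewrite in_itv/= => /andP[at_ _]; rewrite derive1E.
  exact: (@derive_val _ _ _ _ _ _ _ (is_derive_primitive (lt_trans a0 at_))).
Qed.

Lemma integral_integrand_lty :
  (\int[mu]_(t in `]0%R, +oo[) (integrand t)%:E < +oo)%E.
Proof.
pose I n : set R := `[n.+2%:R^-1, n.+2%:R]%classic.
have -> : [set` `]0%R, +oo[%R] = \bigcup_n I n.
  apply/seteqP; split => t; rewrite /= in_itv/= ?andbT.
    move=> t0; have [n hn] : exists n, t + t^-1 < n.+2%:R.
      exists (Num.truncn (t + t^-1)); apply: lt_le_trans (truncnS_gt _) _.
      by rewrite ler_nat.
    exists n => //; rewrite /I/= in_itv/=; apply/andP; split.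
      rewrite invf_ple ?posrE //; apply: le_trans (ltW hn).
      by rewrite lerDr ltW.
    by apply: le_trans (ltW hn); rewrite lerDl invr_ge0 ltW.
  case=> n _; rewrite /I/= in_itv/= => /andP[h _]; apply: lt_le_trans h.
  by rewrite invr_gt0.
have ndI : nondecreasing_seq I.
  move=> m n mn; apply/subsetPset => t; rewrite /I/= !in_itv/= => /andP[h1 h2].
  apply/andP; split; last by apply: le_trans h2 _; rewrite ler_nat !ltnS.
  by apply: le_trans h1; rewrite lef_pV2 ?posrE // ler_nat !ltnS.
have h := ge0_nondecreasing_set_cvg_integral (mu := mu) ndI (fun=> measurable_itv _)
  (fun n => proj2 (measurable_EFinP (I n) integrand) (@measurable_integrand (I n)))
  (fun n t _ => integrand_ge0 t).
apply: (@le_lt_trans _ _ ((x + 1) `^ (x + 1) / x)%:E); last exact: ltry.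
apply: cvge_to_le h _.
apply: nearW => n; apply: integral_integrand_le; first by rewrite invr_gt0.
by rewrite (@lt_trans _ _ 1) ?invf_lt1 ?ltr1n.
Qed.

(** [Gamma] is a real-valued integral, hence [0] by convention if the integral
    diverges; so positivity needs convergence besides a lower bound, which is
    read off the interval [[1, 2]]. *)
Lemma Gamma_gt0 : 0 < Gamma x.
Proof.
apply: fine_gt0; rewrite integral_integrand_lty andbT.
have c0 : 0 < 2^-1 * expR (- 2) :> R by rewrite mulr_gt0 ?expR_gt0.
apply: (@lt_le_trans _ _ (\int[mu]_(t in `[1%R, 2%R]) (2^-1 * expR (- 2))%:E)%E).
  rewrite integral_cst //= lebesgue_measure_itv /= lte_fin ltr1n.
  rewrite -EFinB -EFinM lte_fin.
  by rewrite mulr_gt0 // subr_gt0 ltr1n.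
apply: (@le_trans _ _ (\int[mu]_(t in `[1%R, 2%R]) (integrand t)%:E)%E).
  apply: ge0_le_integral => //.
  - by apply/measurable_EFinP; exact: measurable_integrand.
  - move=> t /=; rewrite in_itv/= => /andP[t1 t2]; rewrite lee_fin.
    have t0 : 0 < t by exact: lt_le_trans t1.
    apply: ler_pM; rewrite ?invr_ge0 ?expR_ge0 // ?ler_expR ?lerN2 //.
    apply: (@le_trans _ _ (t `^ (- 1))).
      by rewrite powR_inv1 ?(ltW t0) // lef_pV2 ?posrE.
    by apply: ler_powR => //; rewrite lerDr ltW.
apply: ge0_subset_integral => //.
- by apply/measurable_EFinP; exact: measurable_integrand.
- by move=> t _; rewrite lee_fin integrand_ge0.
- move=> t /=; rewrite !in_itv/= andbT => /andP[t1 _]; exact: lt_le_trans t1.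
Qed.
End Gamma.

(** * The stiffness matrix *)

(** A distance occurs at most twice among the distances from [i]. *)
Lemma sum_dist_le (R : numDomainType) (u : nat -> R) (N i : nat) :
  (forall l, 0 <= u l) -> (0 < i < N)%N ->
  \sum_(1 <= k < N | k != i) u (absz (i%:Z - k%:Z)) <= 2 * \sum_(1 <= l < N) u l.
Proof.
move=> u0 /andP[i0 iN].
have mono m : (m <= N)%N -> \sum_(1 <= l < m) u l <= \sum_(1 <= l < N) u l.
  case: m => [|m] mN; first by rewrite big_geq // sumr_ge0.
  by rewrite [leRHS](@big_cat_nat _ _ _ m.+1) //= lerDl sumr_ge0.
have iN' := ltnW iN; rewrite (@big_cat_nat _ _ _ i) //=.
rewrite [X in _ + X]big_ltn_cond // eqxx /=.
rewrite mulr2n mulrDl mul1r lerD //.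
  rewrite big_nat_rev big_nat_cond [X in X <= _](_ : _ = \sum_(1 <= l < i) u l).
    exact/mono/ltnW.
  rewrite [RHS]big_nat_cond; apply: eq_big => k; first by lia.
  by move=> hk; congr u; lia.
rewrite -[i.+1]add1n big_addn big_nat_cond.
rewrite [X in X <= _](_ : _ = \sum_(1 <= l < N - i) u l).
  exact/mono/leq_subr.
rewrite [RHS]big_nat_cond; apply: eq_big => k; first by lia.
by move=> hk; congr u; lia.
Qed.

Lemma mesh_gt0 (R : realType) (L : R) (N : nat) :
  0 < L -> (2 <= N)%N -> 0 < mesh L N.
Proof. by move=> L0 N2; rewrite divr_gt0 ?mulr_gt0 // ltr0n ltnW. Qed.

Section Stiffness.
Variables (R : realType) (L alpha : R) (N : nat).
Hypotheses (alpha12 : 1 < alpha < 2) (L_gt0 : 0 < L) (N_ge2 : (2 <= N)%N).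

Lemma nu_gt0 : 0 < nu alpha.
Proof. by move: alpha12; rewrite /nu /gam => /andP[]; lra. Qed.

Lemma ch_gt0 : 0 < ch L alpha N.
Proof.
have /andP[a1 a2] := alpha12.
rewrite /ch /c1 !(divr_gt0, mulr_gt0, powR_gt0, nu_gt0, mesh_gt0, Gamma_gt0) //.
- lra.
- lra.
- by rewrite sqrtr_gt0 pi_gt0.
- lra.
Qed.

Definition gterm (l : nat) : R :=
  ((l%:R + 1) `^ nu alpha - (l%:R - 1) `^ nu alpha) / l%:R `^ gam alpha.

Lemma gterm_ge0 l : 0 <= gterm l.
Proof.
case: l => [|l].
  (* The denominator 0 ^ gam is 0, and so is the quotient by it. *)
  rewrite /gterm powR0 ?invr0 ?mulr0 //.
  by rewrite gt_eqF // /gam; move: alpha12 => /andP[]; lra.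
have l1 : 1 <= l.+1%:R :> R by rewrite ler1n.
rewrite /gterm divr_ge0 ?powR_ge0 // subr_ge0.
rewrite ge0_ler_powR ?nnegrE ?(ltW nu_gt0) //; lra.
Qed.

Lemma gE (z : int) : z != 0 -> g alpha N z = - (gterm (absz z) / 2).
Proof. by move=> z0; rewrite /g (negPf z0) /gterm mulNr invfM mulrA mulrAC. Qed.

Lemma gC (i k : nat) : g alpha N (i%:Z - k%:Z) = g alpha N (k%:Z - i%:Z).
Proof. by rewrite /g -opprB oppr_eq0 abszN. Qed.

(** The last two terms in the definition of [g0] are what makes the diagonal
    dominance strict. *)
Lemma sum_gterm_lt_g0 : \sum_(1 <= l < N) gterm l < g0 alpha N.
Proof.
have /andP[a1 a2] := alpha12.
have N1 : 1 <= N%:R :> R by rewrite ler1n; lia.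
rewrite /g0 -addrA ltrDl ltr_wpDl //.
  rewrite divr_ge0 ?powR_ge0 // subr_ge0 ge0_ler_powR ?nnegrE ?(ltW nu_gt0) //; lra.
by rewrite divr_gt0 ?mulr_gt0 ?powR_gt0 ?nu_gt0 //; lra.
Qed.

(** The matrix of [- delta_h] on [V0h].  The identity on the two boundary nodes
    makes it positive definite on the whole space of grid functions, so that its
    inverse and its square root can be taken as those of a matrix. *)
Definition stiff : 'M[R]_N.+1 :=
  \matrix_(i, k) if (0 < i < N)%N && (0 < k < N)%N
                 then ch L alpha N * g alpha N (i%:Z - k%:Z) else (i == k)%:R.

Lemma stiff_sym : stiff^T = stiff.
Proof. by apply/matrixP => i k; rewrite !mxE andbC gC eq_sym. Qed.

Lemma stiff_posdef : posdef_mx stiff.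
Proof.
apply: diag_dominant_posdef stiff_sym _ => i.
have [iN|/negPf iN] := boolP (0 < i < N)%N; last first.
  rewrite mxE iN /= eqxx big1 ?ltr01 // => k ki.
  by rewrite mxE iN /= eq_sym (negPf ki) normr0.
rewrite [X in _ < X]mxE iN /= subrr [g _ _ 0]/g eqxx.
apply: (@le_lt_trans _ _ (ch L alpha N * \sum_(1 <= l < N) gterm l)); last first.
  by rewrite ltr_pM2l ?ch_gt0 // sum_gterm_lt_g0.
have -> : \sum_(1 <= l < N) gterm l = 2 * \sum_(1 <= l < N) (gterm l / 2).
  by rewrite -mulr_suml mulrC divfK.
(* Pass from the row over all nodes to the interior ones; the boundary entries
   of the row vanish. *)
apply: (@le_trans _ _ (ch L alpha N *
    \sum_(1 <= k < N | k != i) (gterm (absz (i%:Z - k%:Z)) / 2))); last first.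
  rewrite ler_pM2l ?ch_gt0 //.
  apply: (@sum_dist_le _ (fun l => gterm l / 2)) => // l.
  by rewrite divr_ge0 ?gterm_ge0.
pose f k := if (0 < k < N)%N
            then ch L alpha N * (gterm (absz (i%:Z - k%:Z)) / 2) else 0.
have half_ge0 l : 0 <= gterm l / 2 by rewrite mulr_ge0 ?gterm_ge0.
rewrite (eq_big (fun k : 'I__ => k != i :> nat) (fun k : 'I__ => f k)) //;
    last first => [k ki|].
  rewrite mxE iN /f /=; case: ifP => _; last by rewrite eq_sym (negPf ki) normr0.
  rewrite gE; last by rewrite subr_eq0 eqz_nat eq_sym.
  by rewrite normrM normrN (gtr0_norm ch_gt0) ger0_norm // half_ge0.
rewrite -(big_mkord (fun k => k != i) f) big_mkcond big_ltn //.
rewrite big_nat_recr; last by lia.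
have -> : f 0 = 0 by [].
have -> : f N = 0 by rewrite /f ltnn andbF.
rewrite /= !if_same add0r addr0 mulr_sumr [leRHS]big_mkcond.
rewrite big_nat [leRHS]big_nat; apply: ler_sum => k kN.
by rewrite /f kN.
Qed.
End Stiffness.

(** * Discrete inner product and grid functions vanishing on the boundary *)

Section Inner.
Variables (R : realType) (L : R) (N : nat).
Hypotheses (L_gt0 : 0 < L) (N_ge2 : (2 <= N)%N).
Implicit Types (u v w : 'cV[R]_N.+1) (A : 'M[R]_N.+1).

Lemma dotphE u v : dotph L u v = mesh L N * (u^T *m v) 0 0.
Proof. by rewrite /dotph mxE; congr (_ * _); apply: eq_bigr => k _; rewrite mxE. Qed.

Lemma dotphC u v : dotph L u v = dotph L v u.
Proof. by rewrite /dotph; congr (_ * _); apply: eq_bigr => k _; rewrite mulrC. Qed.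

Lemma dotphDl u v w : dotph L (u + v) w = dotph L u w + dotph L v w.
Proof. by rewrite !dotphE linearD /= mulmxDl mxE mulrDr. Qed.

Lemma dotphZl c u v : dotph L (c *: u) v = c * dotph L u v.
Proof. by rewrite !dotphE linearZ /= -scalemxAl mxE mulrCA. Qed.

Lemma dotphBl u v w : dotph L (u - v) w = dotph L u w - dotph L v w.
Proof. by rewrite -scaleN1r dotphDl dotphZl mulN1r. Qed.

Lemma dotphBr u v w : dotph L w (u - v) = dotph L w u - dotph L w v.
Proof. by rewrite !(dotphC w) dotphBl. Qed.

Lemma dotphZr c u v : dotph L u (c *: v) = c * dotph L u v.
Proof. by rewrite !(dotphC u) dotphZl. Qed.

Lemma dotph_sym A u v : A^T = A -> dotph L (A *m u) v = dotph L u (A *m v).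
Proof. by move=> AT; rewrite !dotphE trmx_mul AT mulmxA. Qed.

Lemma dotph_ge0 u : 0 <= dotph L u u.
Proof.
apply: mulr_ge0; first exact: (ltW (mesh_gt0 L_gt0 N_ge2)).
apply: sumr_ge0 => k _.
by rewrite -expr2 sqr_ge0.
Qed.

Lemma dotph_eq0 u : dotph L u u = 0 -> u = 0.
Proof.
move/eqP; rewrite /dotph mulf_eq0 gt_eqF ?mesh_gt0 //=.
rewrite psumr_eq0 => [/allP u0|k _]; last first.
  by rewrite -expr2 sqr_ge0.
apply/colP => k; have := u0 k; rewrite mem_index_enum => /(_ isT) /=.
by rewrite mulf_eq0 orbb mxE => /eqP.
Qed.

Lemma dotph_posdef A u : posdef_mx A -> u != 0 -> 0 < dotph L (A *m u) u.
Proof.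
move=> Apos u0; rewrite dotphC dotphE mulmxA mulr_gt0 ?mesh_gt0 //; exact: Apos.
Qed.

Lemma dotph_posdef_ge0 A u : posdef_mx A -> 0 <= dotph L (A *m u) u.
Proof.
move=> Apos; have [->|u0] := eqVneq u 0; last exact/ltW/dotph_posdef.
by rewrite mulmx0 dotph_ge0.
Qed.

Lemma dotph_cross_le A u v :
  A^T = A -> (forall w, 0 <= dotph L (A *m w) w) ->
  2 * dotph L (A *m u) v <= dotph L (A *m u) u + dotph L (A *m v) v.
Proof.
move=> AT A_ge0; have := A_ge0 (u - v).
rewrite mulmxBr dotphBl !dotphBr (dotph_sym v u AT) (dotphC v); lra.
Qed.

Lemma normph2E u : normph L 2 u = dotph L u u.
Proof.
rewrite /normph /dotph; congr (_ * _); apply: eq_bigr => k _.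
by rewrite real_normK ?num_real // expr2.
Qed.

Lemma V0hP u : V0h u <-> forall i : 'I_N.+1, (0 < i < N)%N = false -> u i 0 = 0.
Proof.
split=> [[u0 uN] i iN|h]; last by split; apply: h => //=; rewrite ltnn andbF.
have [i0|iN'] : i = ord0 \/ i = ord_max.
- have := ltn_ord i; rewrite ltnS leq_eqVlt => /orP[/eqP e|iltN].
    by right; exact: val_inj.
  by left; apply: val_inj => /=; move: iN; rewrite iltN andbT lt0n => /negbFE/eqP.
- by rewrite i0.
- by rewrite iN'.
Qed.

Lemma V0hB u v : V0h u -> V0h v -> V0h (u - v).
Proof. by move=> [u0 uN] [v0 vN]; split; rewrite !mxE ?u0 ?v0 ?uN ?vN subrr. Qed.

Lemma V0hZ c u : V0h u -> V0h (c *: u).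
Proof. by move=> [u0 uN]; split; rewrite !mxE ?u0 ?uN mulr0. Qed.

Lemma V0hD u v : V0h u -> V0h v -> V0h (u + v).
Proof. by move=> [u0 uN] [v0 vN]; split; rewrite !mxE ?u0 ?v0 ?uN ?vN addr0. Qed.

Lemma V0h_horner_mx A p : (forall v, V0h v -> V0h (A *m v)) ->
  forall v, V0h v -> V0h (horner_mx A p *m v).
Proof.
move=> AV; elim/poly_ind: p => [|p c IHp] v Vv.
  by rewrite rmorph0 mul0mx; split; rewrite mxE.
rewrite rmorphD rmorphM /= horner_mx_X horner_mx_C mulmxDl -mulmxA mul_scalar_mx.
by apply: V0hD; [apply/IHp/AV|apply: V0hZ].
Qed.

End Inner.

(** * Inverse and square root of the discrete operator *)

Section Operators.
Variables (R : realType) (L alpha : R) (N : nat).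
Hypothesis N_ge2 : (2 <= N)%N.
Implicit Types (u v w : 'cV[R]_N.+1).
Let A := stiff L alpha N.

Lemma stiff_boundary v (i : 'I_N.+1) : (0 < i < N)%N = false -> (A *m v) i 0 = v i 0.
Proof.
move=> iN; rewrite mxE (bigD1 i) //= big1 ?addr0 => [|k ki].
  by rewrite mxE iN /= eqxx mul1r.
by rewrite mxE iN /= eq_sym (negPf ki) mul0r.
Qed.

Lemma V0h_stiff v : V0h (A *m v) <-> V0h v.
Proof.
by rewrite !V0hP; split => h i iN; have := h i iN; rewrite stiff_boundary.
Qed.

Lemma delta_h_stiff v : V0h v -> - delta_h L alpha v = A *m v.
Proof.
move=> Vv; have /V0hP vb := Vv; apply/colP => i.
have [iN|/negbTE iN] := boolP (0 < i < N)%N; last first.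
  by rewrite stiff_boundary // vb // !mxE iN oppr0.
rewrite !mxE iN mulNr opprK mulr_sumr.
rewrite (eq_bigr (fun k : 'I__ => A i (inord k) * v (inord k) 0)); last first.
  by move=> k _; rewrite inord_val.
rewrite -(big_mkord xpredT (fun k => A i (inord k) * v (inord k) 0)).
rewrite big_ltn // big_nat_recr; last by lia.
rewrite /= !(vb (inord _)) ?mulr0 ?add0r ?addr0 ?inordK ?ltnn ?andbF //.
rewrite !big_nat; apply: eq_bigr => k kN.
by rewrite mxE iN inordK ?kN ?mulrA //; lia.
Qed.

Hypotheses (alpha12 : 1 < alpha < 2) (L_gt0 : 0 < L).
Let A_sym : A^T = A := stiff_sym L alpha N.
Let A_pos : posdef_mx A := stiff_posdef alpha12 L_gt0 N_ge2.
Let A_unit : A \in unitmx := posdef_unitmx A_pos.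

(** The operator picked by [xget] solves [- delta_h w = u] in [V0h], and
    [invmx A *m u] is the only such [w]. *)
Lemma inv_delta_h_stiff u : V0h u -> inv_delta_h L alpha u = invmx A *m u.
Proof.
move=> Vu; have Vw : V0h (invmx A *m u) by apply/V0h_stiff; rewrite mulKVmx.
have [|Vx xu] := @xgetPex _ 0 [set w | V0h w /\ - delta_h L alpha w = u]%classic.
  by exists (invmx A *m u); split=> //; rewrite delta_h_stiff // mulKVmx.
by rewrite /inv_delta_h -[in RHS]xu delta_h_stiff // mulKmx.
Qed.

(** The square of a polynomial fourth root of the stiffness matrix is a positive
    square root; as a polynomial in that matrix it preserves [V0h]. *)
Lemma exists_pos_sqrt : exists S : 'M[R]_N.+1, is_pos_sqrt L alpha S.
Proof.
have [p pA] := sym_posdef_poly_root4 A_sym A_pos.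
set B := horner_mx A p in pA.
have BT : B^T = B by rewrite /B trmx_horner_mx A_sym.
have BV v : V0h v -> V0h (B *m v).
  by apply: V0h_horner_mx => w Vw; apply/V0h_stiff.
have BA v : B *m (B *m (B *m (B *m v))) = A *m v.
  by rewrite -pA !exprS expr0 mulr1 -!mulmxE -!mulmxA.
exists (B *m B); split => [v Vv|u v _ _|v _ v0|v Vv].
- by rewrite -mulmxA; apply/BV/BV.
- by apply: dotph_sym; rewrite trmx_mul BT.
- rewrite -mulmxA dotph_sym // lt_def dotph_ge0 // andbT.
  apply: contra_neq v0 => /(dotph_eq0 L_gt0 N_ge2) Bv0.
  by rewrite -(mulKmx A_unit v) -BA Bv0 !mulmx0.
- by rewrite delta_h_stiff // -BA -!mulmxA.
Qed.

(** [(S v, S v) = (S (S v), v)], whichever positive square root [S] is picked. *)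
Lemma normph2_sqrt_delta_h v : V0h v ->
  normph L 2 (sqrt_delta_h L alpha v) = dotph L (A *m v) v.
Proof.
move=> Vv; rewrite /sqrt_delta_h normph2E.
have [VS Ssym _ S2] :=
  @xgetPex _ 0 [set S | is_pos_sqrt L alpha S]%classic exists_pos_sqrt.
by rewrite Ssym //; [rewrite S2 // delta_h_stiff // dotphC|exact: VS].
Qed.

Lemma invmx_stiff_sym : (invmx A)^T = invmx A.
Proof. by rewrite trmx_inv A_sym. Qed.

Lemma dotph_invmx_stiff_ge0 u : 0 <= dotph L (invmx A *m u) u.
Proof.
rewrite -[X in dotph _ _ X](mulKVmx A_unit) dotphC.
exact: dotph_posdef_ge0.
Qed.

(** Expand the square of the negative norm of [u - c *: (A *m u)]. For varying
    [c] this is the interpolation of the plain norm between the negative norm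
    and the energy norm. *)
Lemma dotph_le_stiff (c : R) u :
  2 * c * dotph L u u <=
  dotph L (invmx A *m u) u + c ^+ 2 * dotph L (A *m u) u.
Proof.
have := dotph_invmx_stiff_ge0 (u - c *: (A *m u)).
rewrite mulmxBr -scalemxAr mulKmx // dotphBl !dotphBr !dotphZl !dotphZr.
rewrite (dotph_sym L u (A *m u)) ?invmx_stiff_sym // mulKmx // (dotphC L u (A *m u)).
lra.
Qed.

End Operators.

(** * Energy dissipation *)

(** Convexity handles [a ^ 3]. In the concave part [a] is replaced by its
    extrapolation [2 * b - c]: treating it as [a] loses [(a - b) ^ 2 / 2], and
    the defect [a - 2 * b + c = (a - b) - (b - c)], multiplied by [a - b], gives
    this back at the price of [(b - c) ^ 2 / 2]. *)
Lemma double_well_step (R : realFieldType) (a b c : R) :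
  4^-1 * (a ^+ 4 - b ^+ 4) - 2^-1 * (a ^+ 2 - b ^+ 2) - 2^-1 * (b - c) ^+ 2
  <= (a ^+ 3 - 2 * b + c) * (a - b).
Proof.
rewrite -subr_ge0.
have -> : (a ^+ 3 - 2 * b + c) * (a - b) - (4^-1 * (a ^+ 4 - b ^+ 4) -
    2^-1 * (a ^+ 2 - b ^+ 2) - 2^-1 * (b - c) ^+ 2) =
  4^-1 * ((a - b) ^+ 2 * (2 * a ^+ 2 + (a + b) ^+ 2)) + 2^-1 * (a - 2 * b + c) ^+ 2.
  by field.
by rewrite !(sqr_ge0, addr_ge0, mulr_ge0).
Qed.

Section Step.
Variables (R : realType) (L alpha eps sigma tau : R) (N : nat).
Hypotheses (alpha12 : 1 < alpha < 2) (L_gt0 : 0 < L) (N_ge2 : (2 <= N)%N).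
Hypotheses (tau_gt0 : 0 < tau) (sigma_ge : 1 / 16 <= sigma).
Variables (pnew p pold : 'cV[R]_N.+1).
Hypotheses (Vnew : V0h pnew) (Vp : V0h p) (Vold : V0h pold).
Hypothesis scheme : forall i : 'I_N.+1, (1 <= i <= N - 1)%N ->
  (3 * pnew i 0 - 4 * p i 0 + pold i 0) / (2 * tau) =
  delta_h L alpha (mu_bdf2 L alpha eps sigma tau pnew p pold) i 0.

Let A := stiff L alpha N.
Let d := pnew - p.
Let e := p - pold.
Let mu := mu_bdf2 L alpha eps sigma tau pnew p pold.
Let w : 'cV[R]_N.+1 := \col_i (pnew i 0 ^+ 3 - 2 * p i 0 + pold i 0).

Lemma mu_bdf2E : mu = w + (eps ^+ 2 *: (A *m pnew) + (sigma * tau) *: (A *m d)).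
Proof.
have Vd := V0hB Vnew Vp.
rewrite /A -!delta_h_stiff // /mu /mu_bdf2 -/d.
move: (delta_h _ _ pnew) (delta_h _ _ d) => D1 D2.
by apply/colP => i; rewrite !mxE; ring.
Qed.

Lemma V0h_mu : V0h mu.
Proof.
rewrite mu_bdf2E; apply: V0hD.
  have [n0 nN] := Vnew; have [p0 pN] := Vp; have [c0 cN] := Vold.
  by split; rewrite mxE ?n0 ?p0 ?c0 ?nN ?pN ?cN expr0n mulr0 subr0 addr0.
apply: V0hD; apply: V0hZ; apply/V0h_stiff => //; exact: V0hB.
Qed.

(** The scheme only constrains the interior nodes, but both sides vanish on the
    boundary. *)
Lemma scheme_stiff : 3 *: d - e = - (2 * tau) *: (A *m mu).
Proof.
have t0 : 2 * tau != 0 by rewrite gt_eqF // mulr_gt0.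
have Vd := V0hB Vnew Vp; have Ve := V0hB Vp Vold.
have Vl := V0hB (V0hZ 3 Vd) Ve; have Vr : V0h (A *m mu) by apply/V0h_stiff/V0h_mu.
apply/colP => i; have [iN|/negbTE iN] := boolP (0 < i < N)%N; last first.
  by rewrite (proj1 (V0hP _) Vl) // (proj1 (V0hP _) (V0hZ _ Vr)).
have iN' : (1 <= i <= N - 1)%N by lia.
have := scheme iN'; rewrite -/mu => h.
rewrite /A -delta_h_stiff //; last exact: V0h_mu.
rewrite scalerN scaleNr opprK [RHS]mxE -h.
by rewrite mulrC divfK // !mxE; ring.
Qed.

Lemma dotph_w_ge :
  4^-1 * (normph L 4 pnew - normph L 4 p) - 2^-1 * (dotph L pnew pnew - dotph L p p)
  - 2^-1 * dotph L e e <= dotph L w d.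
Proof.
rewrite /normph /dotph -!mulrBr.
rewrite ![_ * (mesh L N * _)]mulrCA -!mulrBr ler_pM2l ?mesh_gt0 //.
rewrite -!sumrB !mulr_sumr -!sumrB; apply: ler_sum => k _.
have norm4 (x : R) : `|x| ^+ 4 = x ^+ 4.
  by rewrite (exprM _ 2 2) real_normK ?num_real // -exprM.
rewrite !mxE -!expr2 !norm4; exact: double_well_step.
Qed.

(** Each intermediate inequality bounds one term of the scheme paired with [d] in
    the negative inner product; the conclusion is a linear combination of them. *)
Lemma modEh_step : modEh L alpha eps tau pnew p <= modEh L alpha eps tau p pold.
Proof.
have Vd := V0hB Vnew Vp; have Ve := V0hB Vp Vold.
rewrite /modEh /Eh /norm_m1_sq !inv_delta_h_stiff //.
rewrite !normph2_sqrt_delta_h // !normph2E -/A -/d -/e.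
have A_unit : A \in unitmx := posdef_unitmx (stiff_posdef alpha12 L_gt0 N_ge2).
(* With the factor 1 / tau built in, the final combination has coefficients
   free of tau. *)
pose a u v := dotph L (invmx A *m u) v / tau.
pose q v := dotph L (A *m v) v.
have dual u v : dotph L (invmx A *m u) v = tau * a u v.
  by rewrite /a mulrCA divff ?mulr1 // gt_eqF.
have tested : 3 * a d d - a e d = - 2 * dotph L mu d.
  have := congr1 (fun v => dotph L (invmx A *m v) d) scheme_stiff.
  rewrite mulmxBr -!scalemxAr mulKmx // dotphBl !dotphZl !dual => h.
  apply: (mulfI (lt0r_neq0 tau_gt0)); rewrite mulrBr; lra.
have cross : a e d <= (a d d + a e e) / 2.
  have := dotph_cross_le e d (invmx_stiff_sym L alpha N)
    (dotph_invmx_stiff_ge0 N_ge2 alpha12 L_gt0).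
  rewrite !dual -mulrDr mulrCA ler_pM2l //; lra.
have mu_d : dotph L mu d =
    dotph L w d + (eps ^+ 2 * dotph L (A *m pnew) d + sigma * tau * q d).
  by rewrite mu_bdf2E !dotphDl !dotphZl.
have quad : eps ^+ 2 * (2^-1 * (q pnew - q p)) <=
    eps ^+ 2 * dotph L (A *m pnew) d.
  apply: ler_wpM2l; first exact: sqr_ge0.
  have := dotph_cross_le pnew p (stiff_sym L alpha N)
    (fun w => dotph_posdef_ge0 L_gt0 N_ge2 w (stiff_posdef alpha12 L_gt0 N_ge2)).
  rewrite dotphBr -/A /q; lra.
(* This is where sigma >= 1 / 16 enters: tau / 4 balances the interpolation
   inequality so that its left side is exactly half of the plain norm. *)
have stab : 2^-1 * dotph L d d <= a d d + sigma * tau * q d.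
  have := dotph_le_stiff N_ge2 alpha12 L_gt0 (tau / 4) d; rewrite -/A dual -/(q d).
  have : tau / 16 * q d <= sigma * tau * q d.
    apply: ler_wpM2r; first exact/dotph_posdef_ge0/stiff_posdef.
    by rewrite mulrC ler_pM2r //; move: sigma_ge; lra.
  move=> h1 h2; rewrite -(ler_pM2l tau_gt0).
  have : tau * (tau / 16 * q d) <= tau * (sigma * tau * q d) by rewrite ler_pM2l.
  rewrite expr2 in h2; lra.
have well := dotph_w_ge.
have t4 x : 1 / (4 * tau) * (tau * x) = 4^-1 * x.
  by field; rewrite gt_eqF.
rewrite !dual !t4 -/(q pnew) -/(q p).
lra.
Qed.
End Step.

Theorem theorem3p1 (R : realType) (alpha L T eps sigma : R) (M N : nat)
    (phi : nat -> 'cV[R]_N.+1)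
    (halpha : 1 < alpha < 2) (hL : 0 < L) (hT : 0 < T)
    (hM : (1 <= M)%N) (hN : (2 <= N)%N)
    (heps : 0 < eps) (hsigma : 1 / 16 <= sigma)
    (hphi : mBDF2_solution L alpha eps sigma (T / M%:R) M phi) :
  forall k : nat, (1 <= k <= M - 1)%N ->
    modEh L alpha eps (T / M%:R) (phi k.+1) (phi k) <=
    modEh L alpha eps (T / M%:R) (phi k) (phi (k - 1)%N).
Proof.
move=> k hk; have [Vphi scheme] := hphi.
apply: (modEh_step halpha hL hN _ hsigma) => [||||i hi].
- by rewrite divr_gt0 // ltr0n.
- by apply: Vphi; lia.
- by apply: Vphi; lia.
- by apply: Vphi; lia.
- exact: scheme.
Qed.
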